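(* Let $n$ be a natural number with prime factorisation $n=p_1^{\alpha_1}\cdots p_t^{\alpha_t}$. The following are equivalent: (1) every sb-solution of cardinality $n$ is multipermutation; (2) every sb-solution of cardinality $n$ is involutive; (3) every skew brace of order $n$ has finite multipermutation level; (4) every skew brace of order $n$ is right-nilpotent; (5) every skew brace of order $n$ is annihilator nilpotent; (6) every skew brace of order $n$ is a brace; (7) every skew brace of order $n$ is two-sided; (8) every skew brace of order $n$ is a bi-skew brace; (9) every skew brace of order $n$ is $\lambda$-homomorphic; (10) $\alpha_i\le 2$ for every $i$, and $p_i$ does not divide $p_j^{\alpha_j}-1$ for all $i\neq j$.
   Context: A skew brace is a set $A$ with two group structures $(A,+)$ and $(A,\circ)$ such that $a\circ(b+c)=a\circ b-a+a\circ c$ for all $a,b,c\in A$; its order is $|A|$; it is a brace if $(A,+)$ is abelian. Put $\lambda_a(b)=-a+a\circ b$ (so $a\mapsto\lambda_a$ is a homomorphism $(A,\circ)\to\mathrm{Aut}(A,+)$) and $a*b=-a+a\circ b-b$; for subsets $X,Y$, $X*Y$ is the subgroup of $(A,+)$ generated by all $x*y$. An ideal is a subgroup $I$ of $(A,+)$ with $\lambda_a(I)=I$ for all $a$, normal in $(A,+)$ and $(A,\circ)$; quotients by ideals are skew braces. $\mathrm{Soc}(A)=Z(A,+)\cap\mathrm{Ker}(\lambda)$ and $\mathrm{Ann}(A)=Z(A,\circ)\cap\mathrm{Soc}(A)$ are ideals. Define $\mathrm{Soc}_0(A)=\{0\}$, $\mathrm{Soc}_{m+1}(A)/\mathrm{Soc}_m(A)=\mathrm{Soc}(A/\mathrm{Soc}_m(A))$,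 and similarly $\mathrm{Ann}_m(A)$. $A$ has finite multipermutation level if $\mathrm{Soc}_m(A)=A$ for some $m$, and is annihilator nilpotent if $\mathrm{Ann}_m(A)=A$ for some $m$. With $A^{(1)}=A$, $A^{(m+1)}=A^{(m)}*A$, $A$ is right-nilpotent if $A^{(m)}=\{0\}$ for some $m$. $A$ is two-sided if also $(a+b)\circ c=a\circ c-c+b\circ c$ for all $a,b,c$; a bi-skew brace if $(A,\circ,+)$ is also a skew brace; $\lambda$-homomorphic if $\lambda_{a+b}=\lambda_a\lambda_b$ for all $a,b$. A (non-degenerate set-theoretic) solution of the Yang--Baxter equation is a pair $(X,r)$ with $r(x,y)=(\lambda_x(y),\rho_y(x))$ a bijection of $X\times X$ satisfying $r_{12}r_{23}r_{12}=r_{23}r_{12}r_{23}$ with all $\lambda_x,\rho_x$ bijective; it is involutive if $r^2=\mathrm{id}$. Its retraction is the solution induced on $X/{\sim}$, where $x\sim y$ iff $\lambda_x=\lambda_y$ and $\rho_x=\rho_y$, by $([x],[y])\mapsto([\lambda_x(y)],[\rho_y(x)])$; $(X,r)$ is multipermutation if some iterated retraction has one element. An sb-solution of cardinality $n$ is a solution isomorphic to $(A,r_A)$ for a skew brace $A$ of order $n$, where $r_A(a,b)=(\lambda_a(b),\lambda_a(b)^{-1}\circ a\circ b)$ (inverse in $(A,\circ)$). *)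

(* Defs.v *)
From mathcomp Require Import all_boot.
Set Implicit Arguments. Unset Strict Implicit. Unset Printing Implicit Defensive.

Record skew_brace (T : Type) := SkewBrace {
  sb_add : T -> T -> T; sb_zero : T; sb_opp : T -> T;
  sb_circ : T -> T -> T; sb_one : T; sb_inv : T -> T;
  sb_addA : forall a b c, sb_add a (sb_add b c) = sb_add (sb_add a b) c;
  sb_add0l : forall a, sb_add sb_zero a = a;
  sb_add0r : forall a, sb_add a sb_zero = a;
  sb_addNl : forall a, sb_add (sb_opp a) a = sb_zero;
  sb_addNr : forall a, sb_add a (sb_opp a) = sb_zero;
  sb_circA : forall a b c, sb_circ a (sb_circ b c) = sb_circ (sb_circ a b) c;
  sb_circ1l : forall a, sb_circ sb_one a = a;
  sb_circ1r : forall a, sb_circ a sb_one = a;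
  sb_circVl : forall a, sb_circ (sb_inv a) a = sb_one;
  sb_circVr : forall a, sb_circ a (sb_inv a) = sb_one;
  sb_compat : forall a b c,
    sb_circ a (sb_add b c) = sb_add (sb_add (sb_circ a b) (sb_opp a)) (sb_circ a c)
}.

Section SkewBraceNotions.
Variables (T : Type) (A : skew_brace T).
Local Notation "a + b" := (sb_add A a b).
Local Notation "- a" := (sb_opp A a).
Local Notation "0" := (sb_zero A).
Local Notation "a 'o' b" := (sb_circ A a b) (at level 40, left associativity).

Definition sb_lambda (a b : T) : T := - a + (a o b).
Definition sb_star (a b : T) : T := (- a + (a o b)) + - b.

Definition add_subgroup (P : T -> Prop) : Prop :=
  [/\ P 0, forall x y, P x -> P y -> P (x + y) & forall x, P x -> P (- x)].

Definition add_gen (S : T -> Prop) (x : T) : Prop :=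
  forall P, add_subgroup P -> (forall y, S y -> P y) -> P x.

Definition star_sub (X Y : T -> Prop) : T -> Prop :=
  add_gen (fun z => exists x y, [/\ X x, Y y & z = sb_star x y]).

(* right_series k = A^(k+1) *)
Fixpoint right_series (k : nat) : T -> Prop :=
  if k is k'.+1 then star_sub (right_series k') (fun _ => True)
  else (fun _ => True).

Definition right_nilpotent : Prop :=
  exists k, forall x, right_series k x -> x = 0.

(* x + I lies in Soc(A/I) (for an ideal I), written out on representatives:
   x + I central in (A/I,+) and lambda_{x+I} = id on A/I *)
Definition soc_mod (I : T -> Prop) (x : T) : Prop :=
  (forall y, I (- (y + x) + (x + y))) /\ (forall y, I (- y + sb_lambda x y)).

(* x + I lies in Ann(A/I) = Z(A/I,o) /\ Soc(A/I) *)
Definition ann_mod (I : T -> Prop) (x : T) : Prop :=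
  soc_mod I x /\ (forall y, I ((sb_inv A (y o x)) o (x o y))).

Fixpoint soc_series (m : nat) : T -> Prop :=
  if m is m'.+1 then soc_mod (soc_series m') else (fun x => x = 0).

Fixpoint ann_series (m : nat) : T -> Prop :=
  if m is m'.+1 then ann_mod (ann_series m') else (fun x => x = 0).

Definition finite_mp_level : Prop := exists m, forall x, soc_series m x.
Definition annihilator_nilpotent : Prop := exists m, forall x, ann_series m x.

Definition is_brace : Prop := forall a b, a + b = b + a.

Definition two_sided : Prop :=
  forall a b c, (a + b) o c = ((a o c) + - c) + (b o c).

(* (A, o, +) is a skew brace: a + (b o c) = (a + b) o a^- o (a + c) *)
Definition bi_skew_brace : Prop :=
  forall a b c, a + (b o c) = ((a + b) o (sb_inv A a)) o (a + c).

Definition lambda_homomorphic : Prop :=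
  forall a b y, sb_lambda (a + b) y = sb_lambda a (sb_lambda b y).

Definition sb_sol (p : T * T) : T * T :=
  let: (a, b) := p in (sb_lambda a b, (sb_inv A (sb_lambda a b)) o (a o b)).

End SkewBraceNotions.

(* r (x,y) = (lambda_x(y), rho_y(x)) *)
Definition sol_iso (X Y : Type) (r : X * X -> X * X) (s : Y * Y -> Y * Y) : Prop :=
  exists f : X -> Y, bijective f /\
    forall x y, s (f x, f y) = (f (r (x, y)).1, f (r (x, y)).2).

Definition sb_solution (n : nat) (X : Type) (r : X * X -> X * X) : Prop :=
  exists (T : finType) (A : skew_brace T), #|T| = n /\ sol_iso (sb_sol A) r.

Definition involutive_sol (X : Type) (r : X * X -> X * X) : Prop :=
  forall p, r (r p) = p.

(* ret_rel r k : the equivalence on X whose classes are the elements of the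
   k-th iterated retraction: x ~_{k+1} y iff lambda_x and lambda_y (resp.
   rho_x and rho_y) induce the same map on X/~_k *)
Fixpoint ret_rel (X : Type) (r : X * X -> X * X) (k : nat) : X -> X -> Prop :=
  if k is k'.+1 then
    fun x y => forall z, ret_rel r k' (r (x, z)).1 (r (y, z)).1 /\
                         ret_rel r k' (r (z, x)).2 (r (z, y)).2
  else (fun x y => x = y).

Definition multipermutation (X : Type) (r : X * X -> X * X) : Prop :=
  exists k, forall x y, ret_rel r k x y.

Definition all_sb_sol (n : nat) (P : forall X : Type, (X * X -> X * X) -> Prop) : Prop :=
  forall (X : Type) (r : X * X -> X * X), @sb_solution n X r -> P X r.

Definition all_sb (n : nat) (P : forall T : Type, skew_brace T -> Prop) : Prop :=
  forall (T : finType) (A : skew_brace T), #|T| = n -> P T A.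

Definition cond10 (n : nat) : Prop :=
  (forall p, p \in primes n -> logn p n <= 2) /\
  (forall p q, p \in primes n -> q \in primes n -> p != q ->
     ~~ (p %| q ^ logn q n - 1)).

(* Main.v *)
From HB Require Import structures.
Require Import Defs.
From mathcomp Require Import all_boot all_fingroup all_algebra all_solvable all_field.
From mathcomp Require Import ring.
Set Implicit Arguments. Unset Strict Implicit. Unset Printing Implicit Defensive.

(* If n satisfies the arithmetic condition then every group of order n is abelian:
   a counterexample of minimal order is a minimal nonabelian group with trivial
   centre; its maximal subgroups are abelian and pairwise meet trivially, so
   counting conjugates yields a normal one, which is a Sylow p-subgroup acted on
   without nontrivial fixed points by an element of order q, whence q divides
   p^a - 1. So both groups of a skew brace A of order n are abelian and (A, +, * )
   is a commutative radical ring. If a * (b * c) <> 0 in its p-part P, then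
   0 < P * (b * c) < P * c < P contradicts |P| <= p^2; so a * (b * c) = 0 always, and
   all of (1)-(9) follow.

   Conversely, all properties pass from A x B to A, so it is enough to find
   counterexamples of order p^3 and of order p q^k with p | q^k - 1. The former is
   a skew brace on F_p^3 with trivial socle, whose circle group is the Heisenberg
   group (for (2) and (6), the trivial skew brace on that group); the latter live on the set Z/p x GF(q^k), one of the two groups being the
   direct and the other the semidirect product. *)

(** * Inheritance of the arithmetic condition by divisors *)

(** The exponent of q can only drop from 2 to 1 without vanishing, and q - 1 divides q^2 - 1. *)
Lemma cond10_dvd m n : 0 < n -> m %| n -> cond10 n -> cond10 m.
Proof.
move=> n_gt0 dvd_mn [cubefree_n not_dvd_n].
have sub_primes p : p \in primes m -> p \in primes n.
  rewrite !mem_primes n_gt0 /= => /and3P[-> _ /dvdn_trans]; exact.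
have le_log p : logn p m <= logn p n by exact: dvdn_leq_log.
split=> [p pm | p q pm qm neq_pq].
  exact: leq_trans (le_log p) (cubefree_n p (sub_primes p pm)).
have := not_dvd_n p q (sub_primes p pm) (sub_primes q qm) neq_pq.
apply: contra => /dvdn_trans; apply.
have: 0 < logn q m by rewrite logn_gt0.
have := le_log q; have := cubefree_n q (sub_primes q qm).
move: (logn q m) (logn q n) => [|[|[|k]]] [|[|[|l]]] // _ _ _.
by rewrite -[X in _ ^ 2 - X](exp1n 2) subn_sqr expn1 dvdn_mulr.
Qed.

(** * Minimal nonabelian groups with trivial centre *)

Section MinimalNonabelian.
Local Open Scope group_scope.
Variables (gT : finGroupType) (G : {group gT}).
Hypothesis (propG_abelian : forall H : {group gT}, H \proper G -> abelian H).
Hypotheses (nabG : ~~ abelian G) (Z1 : 'Z(G) = 1).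

Lemma cycle_proper x : x \in G -> <[x]> \proper G.
Proof.
move=> Gx; rewrite properEneq cycle_subG Gx andbT.
by apply: contraNneq nabG => <-; exact: cycle_abelian.
Qed.

Lemma mem_maximal x : x \in G -> exists2 M : {group gT}, maximal M G & x \in M.
Proof.
move=> Gx; have /andP[sxG nsGx] := cycle_proper Gx.
have [defG|[M maxM]] := maximal_exists sxG; first by rewrite defG subxx in nsGx.
by rewrite cycle_subG; exists M.
Qed.

Lemma maximal_neq1 (M : {group gT}) : maximal M G -> M :!=: 1.
Proof.
move=> maxM; apply: contraNneq nabG => M1.
have [->|] := eqVneq (G : {set gT}) 1; first exact: abelian1.
case/trivgPn=> x Gx ntx; case/maxgroupP: maxM => _ /(_ _ (cycle_proper Gx)).
by rewrite M1 sub1G => /(_ isT)/eqP; rewrite cycle_eq1 (negPf ntx).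
Qed.

Lemma maximal_abelian (M : {group gT}) : maximal M G -> abelian M.
Proof. by move/maxgroupp/propG_abelian. Qed.

Lemma maximal_join (M H : {group gT}) :
  maximal M G -> H \subset G -> ~~ (H \subset M) -> M <*> H = G.
Proof.
move=> maxM sHG nsHM; have sMG := proper_sub (maxgroupp maxM).
apply/eqP; rewrite eqEproper join_subG sMG sHG /=.
apply: contra nsHM => prop.
by case/maxgroupP: maxM => _ /(_ _ prop (joing_subl _ _)) <-; exact: joing_subr.
Qed.

(* Two abelian maximal subgroups generate G, so G centralises their intersection. *)
Lemma maximal_meet_sub (M N : {group gT}) x :
  maximal M G -> maximal N G -> x \in M -> x \in N -> x != 1 -> N \subset M.
Proof.
move=> maxM maxN Mx Nx; apply: contraNT => nsNM; rewrite -in_set1 -[[set 1]]Z1.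
have defG := maximal_join maxM (proper_sub (maxgroupp maxN)) nsNM.
rewrite /center inE -{2}defG centY (subsetP (proper_sub (maxgroupp maxM))) //.
rewrite inE (subsetP (maximal_abelian maxM)) //.
by rewrite (subsetP (maximal_abelian maxN)).
Qed.

Lemma maximal_TI (M N : {group gT}) x :
  maximal M G -> maximal N G -> x \in M -> x \in N -> x != 1 -> M :=: N.
Proof.
move=> maxM maxN Mx Nx ntx; apply/eqP; rewrite eqEsubset.
by rewrite !(maximal_meet_sub (x := x)).
Qed.

Lemma maximal_conjG (M : {group gT}) g : g \in G -> maximal M G -> maximal (M :^ g) G.
Proof.
move=> Gg; rewrite -{2}(conjGid Gg) => maxM; exact: etrans (maximalJ _ _ _) maxM.
Qed.

(** By maximality M is its own normaliser, and a conjugate of M meeting it nontrivially equals it by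
    [maximal_TI]. *)
Lemma maximal_normedTI (M : {group gT}) :
  maximal M G -> ~~ (M <| G) -> normedTI M^# G M.
Proof.
move=> maxM nnM; have sMG := proper_sub (maxgroupp maxM).
have defN : 'N_G(M) = M.
  case/maxgroupP: (maxM) => _; apply; last by rewrite subsetI sMG normG.
  rewrite properE subsetIl; apply: contra nnM => sGN.
  by rewrite /normal sMG (subset_trans sGN) ?subsetIr.
apply/normedTI_P; split.
- by rewrite setD_eq0 subG1 maximal_neq1.
- by rewrite normD1 subsetI sMG normG.
move=> g Gg; rewrite -setI_eq0 => /set0Pn[x].
rewrite conjD1g !inE => /andP[/andP[ntx Mx] /andP[_ Mgx]].
have /eqP := maximal_TI maxM (maximal_conjG Gg maxM) Mx Mgx ntx.
by rewrite eq_sym => /eqP MgM; rewrite -defN inE Gg; apply/normP.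
Qed.

(** The conjugates of M number |G : M| and meet trivially, so they cover |G : M| (|M| - 1)
    nonidentity elements; this is at least half of |G| because |M| >= 2. *)
Lemma leq_class_support (M : {group gT}) :
    maximal M G -> ~~ (M <| G) ->
  #|class_support M^# G| + #|G : M| = #|G| /\ #|G| <= #|class_support M^# G|.*2.
Proof.
move=> maxM nnM; have sMG := proper_sub (maxgroupp maxM).
rewrite (card_support_normedTI (maximal_normedTI maxM nnM)) -(Lagrange sMG).
have := maximal_neq1 maxM; rewrite trivg_card1 (cardsD1 1 M) group1.
move: #|M^#| => [|k] // _.
split; first by rewrite addnC mulSn.
by rewrite doubleMl leq_mul2r add1n doubleS !ltnS -addnn leq_addl orbT.
Qed.

(** The conjugates of a non-normal M miss some x <> 1. If a maximal N containing x were not normal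
    either, the two disjoint supports, each of size at least |G|/2, would not fit into [G^#]. *)
Lemma exists_normal_maximal : exists2 M : {group gT}, maximal M G & M <| G.
Proof.
have [M maxM _] := mem_maximal (group1 G).
have [nM|nnM] := boolP (M <| G); first by exists M.
have [cardM leM] := leq_class_support maxM nnM.
have sMG := proper_sub (maxgroupp maxM).
have sub_supp (N : {group gT}) : maximal N G -> class_support N^# G \subset G^#.
  move=> maxN; have sNG := proper_sub (maxgroupp maxN).
  rewrite subsetD1 class_support_subG ?subDset ?subsetU ?sNG ?orbT //=.
  apply/imset2P=> [[x y]]; rewrite !inE => /andP[ntx _] _ /esym/eqP.
  by rewrite conjg_eq1 (negPf ntx).
have [x] : exists x, x \in G^# :\: class_support M^# G.
  apply/set0Pn; rewrite setD_eq0; apply/negP=> /subset_leq_card.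
  have : 1 < #|G : M| by rewrite indexg_gt1 proper_subn // (maxgroupp maxM).
  move=> gt1 le; have := leq_add le gt1.
  by rewrite cardM (cardsD1 1 G) group1 add1n addn2 ltnn.
rewrite 3!inE => /andP[nMx /andP[ntx Gx]].
have [N maxN Nx] := mem_maximal Gx.
have [nN|nnN] := boolP (N <| G); first by exists N.
have [cardN leN] := leq_class_support maxN nnN.
(* A common element of [M :^ g] and [N :^ h] forces these to be equal, which puts a conjugate of x
   into M. *)
have disj : [disjoint class_support M^# G & class_support N^# G].
  rewrite -setI_eq0; apply/eqP/setP=> z; rewrite !inE; apply/negP=> /andP[].
  case/imset2P=> y g; rewrite inE in_set1 => /andP[nty My] Gg ->.
  case/imset2P=> y' h; rewrite inE in_set1 => /andP[nty' Ny'] Gh eqz.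
  have := maximal_TI (maximal_conjG Gg maxM) (maximal_conjG Gh maxN) (x := y ^ g).
  rewrite memJ_conjg My {1}eqz memJ_conjg Ny' conjg_eq1 nty => /(_ isT isT isT).
  move/(congr1 (conjugate^~ h^-1)); rewrite conjsgK -conjsgM => defN.
  case/negP: nMx; rewrite -[x](conjgKV (g * h^-1)) memJ_class_support //.
    by rewrite !inE conjg_eq1 ntx -mem_conjg defN Nx.
  by rewrite groupM ?groupV.
have : #|class_support M^# G :|: class_support N^# G| <= #|G^#|.
  by rewrite subset_leq_card // subUset !sub_supp.
rewrite cardsU disjoint_setI0 // cards0 subn0.
have := cardsD1 1 G; rewrite group1 => eqG leU.
have := leq_add leM leN; rewrite -doubleD addnn leq_double => /leq_trans/(_ leU).
by rewrite eqG ltnn.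
Qed.

End MinimalNonabelian.

(** * Groups whose order satisfies the arithmetic condition *)

Section AbelianNumbers.
Local Open Scope group_scope.

Lemma abelian_of_cond10 (gT : finGroupType) (G : {group gT}) :
  cond10 #|G| -> abelian G.
Proof.
have [n] := ubnP #|G|; elim: n gT G => // n IHn gT G /ltnSE leGn c10.
have propG_abelian (H : {group gT}) : H \proper G -> abelian H.
  move=> prHG; apply: IHn; first exact: leq_trans (proper_card prHG) leGn.
  exact: cond10_dvd (cardG_gt0 G) (cardSg (proper_sub prHG)) c10.
have quoG_abelian (H : {group gT}) : H <| G -> H :!=: 1 -> abelian (G / H).
  move=> nHG ntH; apply: IHn.
    by apply: leq_trans (ltn_quotient ntH (normal_sub nHG)) leGn.
  by apply: cond10_dvd (cardG_gt0 G) _ c10; rewrite dvdn_quotient.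
apply/idPn=> nabG.
have np (p : nat) : ~~ p.-group G.
  apply: contra nabG => pG; have [->|ntG] := eqVneq (G : {set gT}) 1.
    exact: abelian1.
  have [p_pr pdvd _] := pgroup_pdiv pG ntG.
  by rewrite (p2group_abelian pG) // c10.1 // mem_primes p_pr cardG_gt0.
(* With a nontrivial centre, G is nilpotent, hence the product of its p-part and p'-part for p the
   least prime divisor of |G|; both are proper, hence abelian. *)
have [Z1|ntZ] := eqVneq 'Z(G) 1; last first.
  have nilG: nilpotent G.
    by rewrite -quotient_center_nil abelian_nil // quoG_abelian // center_normal.
  have /dprodP[_ defG cO _] := nilpotent_pcoreC (pdiv #|G|) nilG.
  case/negP: nabG; rewrite -defG abelianM cO andbT.
  have prop pi : ~~ pi.-group G -> 'O_pi(G) \proper G.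
    move=> npi; rewrite properEneq pcore_sub andbT.
    by apply: contraNneq npi => <-; exact: pcore_pgroup.
  rewrite !propG_abelian ?prop //; apply/negP=> p'G.
  (* The trivial group is a 2-group, which G is not. *)
  have pG := np 2; have ntG : G :!=: 1.
    by apply: contraNneq pG => ->; exact: pgroup1.
  have gt1 : 1 < #|G| by rewrite cardG_gt1.
  by move: p'G; rewrite /pgroup p'natE ?pdiv_dvd ?pdiv_prime.
have [M maxM nMG] := exists_normal_maximal propG_abelian nabG Z1.
have abM := maximal_abelian propG_abelian maxM.
have ntM := maximal_neq1 nabG maxM; have sMG := normal_sub nMG.
have G'_sub (H : {group gT}) : H <| G -> H :!=: 1 -> G^`(1) \subset H.
  by move=> nHG ntH; rewrite der1_min ?normal_norm ?quoG_abelian.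
(* If M were not a p-group, two nontrivial normal subgroups of coprime orders would
   contain the derived subgroup. *)
pose p := pdiv #|M|.
have p_pr : prime p by rewrite pdiv_prime // cardG_gt1.
have pM : p.-group M.
  have /dprodP[_ defM _ _] := nilpotent_pcoreC p (abelian_nil abM).
  have [O1|ntO'] := eqVneq 'O_p^'(M) 1.
    by rewrite -defM O1 mulg1 pcore_pgroup.
  have [O1|ntO] := eqVneq 'O_p(M) 1.
    have : p^'.-group M by rewrite -defM O1 mul1g pcore_pgroup.
    by rewrite /pgroup p'natE ?pdiv_dvd.
  have nO pi := char_normal_trans (pcore_char pi M) nMG.
  have : G^`(1) \subset 'O_p(M) :&: 'O_p^'(M) by rewrite subsetI !G'_sub.
  rewrite TI_pcoreC => /trivgP/commG1P abG.
  by case/negP: nabG.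
have [q [q_pr qG neq_qp]] : exists q, [/\ prime q, q %| #|G| & q != p].
  have := np p; rewrite /pgroup /pnat cardG_gt0 /= => /allPn[q].
  by rewrite mem_primes inE => /and3P[q_pr _ qG] ?; exists q.
have [x Gx ox] := Cauchy q_pr qG.
have nMx : ~~ (<[x]> \subset M).
  apply/negP=> sxM; have := pgroupS sxM pM.
  by rewrite /pgroup -orderE ox pnatE // inE (negPf neq_qp).
have defG : M <*> <[x]> = G by apply: maximal_join maxM _ nMx; rewrite cycle_subG.
(* G is not a p-group, so a Sylow p-subgroup containing the maximal subgroup M must be M. *)
have [P sylP sMP] := Sylow_superset sMG pM.
have PM : P :=: M.
  case/maxgroupP: maxM => _; apply=> //.
  rewrite properEneq (pHall_sub sylP) andbT.
  by apply: contraNneq (np p) => <-; exact: pHall_pgroup sylP.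
(* Since M is abelian, an element of M commuting with x is central in G = <M, x>. *)
have C1 : 'C_M(<[x]>) = 1.
  apply/trivgP; rewrite -Z1 subsetI subIset ?sMG //= -defG centY subsetI.
  by rewrite subsetIr subIset //; apply/orP; left.
have px : q.-group <[x]> by rewrite /pgroup -orderE ox pnat_id.
have nMx' : [acts <[x]>, on M | 'J].
  by rewrite astabsJ cycle_subG (subsetP (normal_norm nMG)).
(* Counting fixed points modulo q gives |M| = 1 mod q, where |M| is the full p-part of |G|. *)
have := pgroup_fix_mod px nMx'; rewrite afixJ C1 cards1 => /eqP.
rewrite eqn_mod_dvd // -PM (card_Hall sylP) p_part.
apply/negP/c10.2; rewrite ?mem_primes ?cardG_gt0 ?q_pr ?p_pr //=.
exact: dvdn_trans (pdiv_dvd _) (cardSg sMG).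
Qed.

End AbelianNumbers.

(** * Finite commutative radical rings; the group law is the ring addition, [s] the
    multiplication *)

Section RadicalRing.
Local Open Scope group_scope.
Variables (gT : finGroupType) (s : gT -> gT -> gT).
Hypotheses (mulC : forall x y : gT, x * y = y * x).
Hypotheses (sMl : forall x y z, s (x * y) z = s x z * s y z).
Hypotheses (sC : forall x y, s x y = s y x).
Hypotheses (sA : forall x y z, s x (s y z) = s (s x y) z).
Hypotheses (s_fix : forall x y, s x y = y -> y = 1).

Lemma radical_mul1 x : s 1 x = 1.
Proof. by apply: (mulgI (s 1 x)); rewrite -sMl !mulg1. Qed.

Lemma radical_mul1r x : s x 1 = 1.
Proof. by rewrite sC radical_mul1. Qed.

Lemma radical_mulX x y k : s (x ^+ k) y = s x y ^+ k.
Proof.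
by elim: k => [|k IHk]; rewrite ?radical_mul1 // !expgS sMl IHk.
Qed.

Lemma radical_mulXr x y k : s x (y ^+ k) = s x y ^+ k.
Proof. by rewrite sC radical_mulX sC. Qed.

Lemma abelian_setT : abelian [set: gT].
Proof. by apply/centsP=> x _ y _; exact: mulC. Qed.

Variable p : nat.
Let P := 'O_p([set: gT])%G.

Lemma mem_pcore_setT x : (x \in P) = p.-elt x.
Proof.
rewrite (mem_normal_Hall (nilpotent_pcore_Hall p _)) ?pcore_normal ?in_setT //.
exact/abelian_nil/abelian_setT.
Qed.

Lemma pcore_radical_mul x y : x \in P -> s x y \in P.
Proof.
rewrite !mem_pcore_setT; apply: pnat_dvd.
by rewrite order_dvdn -radical_mulX expg_order radical_mul1.
Qed.

Definition pcore_multiples c := [set s x c | x in P].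

Fact pcore_multiples_group_set c : group_set (pcore_multiples c).
Proof.
apply/group_setP; split=> [|_ _ /imsetP[x Px ->] /imsetP[y Py ->]].
  by apply/imsetP; exists 1; rewrite ?group1 ?radical_mul1.
by rewrite -sMl imset_f ?groupM.
Qed.
Canonical pcore_multiples_group c := Group (pcore_multiples_group_set c).

(** The inclusion is strict because c itself is lost: c = x c forces c to be trivial by [s_fix], a
    form of Nakayama's lemma. *)
Lemma pcore_multiples_proper b c :
  c != 1 -> c \in pcore_multiples b -> pcore_multiples c \proper pcore_multiples b.
Proof.
move=> ntc bc; apply/properP; split.
  have /imsetP[y Py ->] := bc; apply/subsetP=> _ /imsetP[x Px ->].
  by rewrite sA imset_f ?pcore_radical_mul.
exists c => //; apply: contra ntc => /imsetP[x _ eqc].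
by apply/eqP; apply: (s_fix (x := x)).
Qed.

Lemma pcore_radical_mul3 a b c :
    logn p #|[set: gT]| <= 2 -> a \in P -> b \in P -> c \in P ->
  s a (s b c) = 1.
Proof.
move=> cubefree Pa Pb Pc; apply/eqP/idPn=> ntabc.
have ntbc : s b c != 1 by apply: contraNneq ntabc => ->; rewrite radical_mul1r.
have ntc : c != 1 by apply: contraNneq ntbc => ->; rewrite radical_mul1r.
have pP : p.-group P := pcore_pgroup _ _.
have sP x : x \in P -> pcore_multiples x \subset P.
  by move=> Px; apply/subsetP=> _ /imsetP[y Py ->]; exact: pcore_radical_mul.
have lt1 : logn p #|pcore_multiples c| < logn p #|P|.
  apply: properG_ltn_log => //; apply/properP; split; first exact: sP.
  exists c => //; apply: contra ntc => /imsetP[x _ eqc].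
  by apply/eqP; apply: (s_fix (x := x)).
have lt2 : logn p #|pcore_multiples (s b c)| < logn p #|pcore_multiples c|.
  apply: properG_ltn_log; first exact: pgroupS (sP _ Pc) pP.
  by apply: pcore_multiples_proper => //; exact: imset_f.
have lt3 : logn p #|[1 gT]| < logn p #|pcore_multiples (s b c)|.
  apply: properG_ltn_log; first exact: pgroupS (sP _ (pcore_radical_mul _ Pb)) pP.
  by rewrite proper1G; apply/trivgPn; exists (s a (s b c)); rewrite ?imset_f.
have := dvdn_leq_log p (cardG_gt0 _) (cardSg (pcore_sub p [set: gT])).
move/leq_trans/(_ cubefree); rewrite leqNgt => /negP; apply.
by rewrite (leq_ltn_trans _ lt1) // (leq_ltn_trans _ lt2) // (leq_ltn_trans _ lt3).
Qed.

End RadicalRing.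

(** Reduction to the p-part: for a prime p dividing the order of abc, the N-th powers of a, b, c lie
    in the p-core, N being the p'-part of the group order. Trilinearity then kills the N^3-th power
    of abc, so p would divide N. *)
Lemma radical_mul3 (gT : finGroupType) (s : gT -> gT -> gT) :
    (forall x y : gT, x * y = y * x)%g ->
    (forall x y z, s (x * y) z = s x z * s y z)%g ->
    (forall x y, s x y = s y x) ->
    (forall x y z, s x (s y z) = s (s x y) z) ->
    (forall x y, s x y = y -> y = 1%g) ->
    (forall p, p \in primes #|gT| -> logn p #|gT| <= 2) ->
  forall a b c, s a (s b c) = 1%g.
Proof.
move=> mulC sMl sC sA s_fix cubefree a b c; apply/eqP; rewrite -order_eq1.
rewrite eqn_leq order_gt0 andbT leqNgt; apply/negP=> o_gt1.
set x := s a _ in o_gt1; pose p := pdiv #[x]%g.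
have p_pr : prime p by exact: pdiv_prime.
have p_dvd : p %| #|gT|.
  by rewrite (dvdn_trans (pdiv_dvd _)) // -cardsT order_dvdG ?in_setT.
have n_gt0 : 0 < #|gT| by rewrite -cardsT cardG_gt0.
pose N := #|gT|`_p^'.
have elt_pN y : (y ^+ N)%g \in 'O_p([set: gT])%g.
  rewrite mem_pcore_setT //; apply: (@pnat_dvd _ #|gT|`_p); last exact: part_pnat.
  rewrite order_dvdn -expgM mulnC partnC // -cardsT.
  by rewrite -order_dvdn order_dvdG ?in_setT.
have := pcore_radical_mul3 mulC sMl sC sA s_fix _ (elt_pN a) (elt_pN b) (elt_pN c).
rewrite cardsT cubefree ?mem_primes ?p_pr ?n_gt0 // => /(_ isT)/eqP.
rewrite !(radical_mulX, radical_mulXr) // -!expgM -order_dvdn.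
move/(dvdn_trans (pdiv_dvd _)); rewrite !Euclid_dvdM //.
suff /negPf-> : ~~ (p %| N) by [].
by rewrite -p'natE // part_pnat.
Qed.

(** * The additive and circle groups of a finite skew brace *)

(** The parameter [A] tags the carrier, so that structure inference can tell the two groups on [T]
    apart. *)
Definition add_group (T : finType) (A : skew_brace T) : Type := T.
HB.instance Definition _ (T : finType) (A : skew_brace T) := Finite.on (add_group A).
HB.instance Definition _ (T : finType) (A : skew_brace T) :=
  Finite_isGroup.Build (add_group A) (sb_addA A) (sb_add0l A) (sb_addNl A).

Definition circ_group (T : finType) (A : skew_brace T) : Type := T.
HB.instance Definition _ (T : finType) (A : skew_brace T) := Finite.on (circ_group A).
HB.instance Definition _ (T : finType) (A : skew_brace T) :=
  Finite_isGroup.Build (circ_group A) (sb_circA A) (sb_circ1l A) (sb_circVl A).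

Lemma card_add_group (T : finType) (A : skew_brace T) : #|{: add_group A}| = #|T|.
Proof. by apply: (@bij_eq_card (add_group A) T id); exists id. Qed.

Lemma card_circ_group (T : finType) (A : skew_brace T) : #|{: circ_group A}| = #|T|.
Proof. by apply: (@bij_eq_card (circ_group A) T id); exists id. Qed.

Lemma group_mulC_of_cond10 (gT : finGroupType) :
  cond10 #|gT| -> forall x y : gT, (x * y = y * x)%g.
Proof.
rewrite -cardsT => /abelian_of_cond10/centsP abG x y.
by apply: abG; rewrite in_setT.
Qed.

(** * Elementary identities in skew braces *)

Section SkewBraceTheory.
Variables (T : Type) (A : skew_brace T).
Local Notation "a + b" := (sb_add A a b).
Local Notation "- a" := (sb_opp A a).
Local Notation "0" := (sb_zero A).
Local Notation "a 'o' b" := (sb_circ A a b) (at level 40, left associativity).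

Lemma sb_addKl a b : - a + (a + b) = b.
Proof. by rewrite sb_addA sb_addNl sb_add0l. Qed.

Lemma sb_addNKl a b : a + (- a + b) = b.
Proof. by rewrite sb_addA sb_addNr sb_add0l. Qed.

Lemma sb_addI a b c : a + b = a + c -> b = c.
Proof. by move=> eqab; rewrite -[b](sb_addKl a) eqab sb_addKl. Qed.

Lemma sb_circKl a b : sb_inv A a o (a o b) = b.
Proof. by rewrite sb_circA sb_circVl sb_circ1l. Qed.

Lemma sb_circNKl a b : a o (sb_inv A a o b) = b.
Proof. by rewrite sb_circA sb_circVr sb_circ1l. Qed.

Lemma sb_circI a b c : a o b = a o c -> b = c.
Proof. by move=> eqab; rewrite -[b](sb_circKl a) eqab sb_circKl. Qed.

Lemma sb_oppK a : - (- a) = a.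
Proof. by apply: (@sb_addI (- a)); rewrite sb_addNr sb_addNl. Qed.

Lemma sb_opp0 : - 0 = 0.
Proof. by rewrite -[- 0](sb_add0r A) sb_addNl. Qed.

Lemma sb_oppD a b : - (a + b) = - b + - a.
Proof. 
by apply: (@sb_addI (a + b)); rewrite sb_addNr -sb_addA sb_addNKl sb_addNr.
Qed.

(** Compatibility at a = [sb_one A], b = c = 0 reads 0 = - [sb_one A]. *)
Lemma sb_one_zero : sb_one A = 0.
Proof.
have := sb_compat A (sb_one A) 0 0.
rewrite sb_add0l !sb_circ1l sb_add0r sb_add0l => /(congr1 (sb_add A (sb_one A))).
by rewrite sb_addNr sb_add0r.
Qed.

Lemma sb_circ0 a : a o 0 = a.
Proof. by rewrite -sb_one_zero sb_circ1r. Qed.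

(* The first component of r^2(a,b) is the additive conjugate of a by a o b. *)
Lemma involutive_sol_brace : involutive_sol (sb_sol A) <-> is_brace A.
Proof.
have sol2 a b : (sb_sol A (sb_sol A (a, b))).1 = - (a o b) + (a + (a o b)).
  by rewrite /sb_sol /= /sb_lambda sb_circNKl sb_oppD sb_oppK sb_addA.
split=> [invr a b | brA [a b]].
  (* This second argument makes the circle product of the pair equal to b, so b runs over all
     conjugating elements. *)
  have := sol2 a (sb_inv A a o b); rewrite invr sb_circNKl /=.
  by move/(congr1 (sb_add A b)); rewrite sb_addNKl.
have fst_ab : (sb_sol A (sb_sol A (a, b))).1 = a by rewrite sol2 (brA a) sb_addKl.
(* The solution preserves the circle product of a pair, so the first component determines the
   second. *)
move: fst_ab; rewrite [sb_sol A (a, b)]/sb_sol; set c := sb_lambda A a b.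
by rewrite /sb_sol /= => ->; rewrite sb_circNKl sb_circKl.
Qed.

Lemma ann_series_sub m x : ann_series A m x -> soc_series A m x.
Proof.
elim: m x => //= m IHm x [[cx lx] _].
by split=> y; apply: IHm.
Qed.

Lemma annihilator_nilpotent_mp : annihilator_nilpotent A -> finite_mp_level A.
Proof. by case=> m annA; exists m => x; exact: ann_series_sub. Qed.

End SkewBraceTheory.

(** * Braces with commutative circle group as radical rings *)

Definition brace_zmod (T : finType) (A : skew_brace T) (brA : is_brace A) : Type := T.
HB.instance Definition _ (T : finType) (A : skew_brace T) (brA : is_brace A) :=
  Finite.on (brace_zmod brA).
HB.instance Definition _ (T : finType) (A : skew_brace T) (brA : is_brace A) :=
  GRing.isZmodule.Build (brace_zmod brA)
    (sb_addA A) brA (sb_add0l A) (sb_addNl A).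

(* Locked, so that rewriting with the zmodType laws does not see the sum inside. *)
Definition brace_star (T : finType) (A : skew_brace T) (brA : is_brace A) :
  brace_zmod brA -> brace_zmod brA -> brace_zmod brA := locked (sb_star A).

Section CommutativeCirc.
Variables (T : finType) (A : skew_brace T).
Hypotheses (brA : is_brace A) (circC : forall a b, sb_circ A a b = sb_circ A b a).
Local Notation V := (brace_zmod brA).
Local Notation "a ∘ b" := (sb_circ A a b : V) (at level 40, left associativity).
Local Notation "a ⋆ b" := (@brace_star T A brA a b) (at level 39, left associativity).
Import GRing.Theory.
Local Open Scope ring_scope.

Lemma starE (a b : V) : sb_star A a b = a ⋆ b.
Proof. by rewrite /brace_star -lock. Qed.

(** This identifies the circle product with the adjoint operation of a radical ring whose
    multiplication is [⋆]. *)
Lemma circE (a b : V) : a ∘ b = a + b + a ⋆ b.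
Proof.
rewrite -starE [X in _ + X](_ : _ = - a + a ∘ b - b) //.
by rewrite addrA [RHS]addrAC addrK addNKr.
Qed.

Lemma lambdaE (a b : V) : sb_lambda A a b = b + a ⋆ b :> V.
Proof.
rewrite [LHS](_ : _ = - a + a ∘ b) // circE.
by rewrite -[a + b + _]addrA addKr.
Qed.

Lemma starC (a b : V) : a ⋆ b = b ⋆ a.
Proof. by apply: (addrI (a + b)); rewrite -circE [a + b]addrC -circE; exact: circC. Qed.

Lemma starDr (a b c : V) : a ⋆ (b + c : V) = a ⋆ b + a ⋆ c.
Proof.
apply: (addrI (a + (b + c))); rewrite -circE.
rewrite [LHS](_ : _ = a ∘ b - a + a ∘ c); last exact: sb_compat.
rewrite !circE -[a + b + _]addrA [a + _ - a]addrAC subrr add0r.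
rewrite [LHS](AC (2*3) (3*1*4*2*5))%AC.
by rewrite [RHS](AC (1*2*2) (1*2*3*4*5))%AC.
Qed.

Lemma starDl (a b c : V) : (a + b : V) ⋆ c = a ⋆ c + b ⋆ c.
Proof. by rewrite starC starDr !(starC c). Qed.

(** Expanding both sides of the associativity of [∘], all terms cancel except the triple
    products. *)
Lemma starA (a b c : V) : a ⋆ (b ⋆ c) = a ⋆ b ⋆ c.
Proof.
have : a ∘ (b ∘ c) = a ∘ b ∘ c := sb_circA A a b c.
rewrite !circE !(starDr, starDl).
rewrite [LHS](AC (1*3*3) ((1*2*5*3*6*4)*7))%AC.
rewrite [RHS](AC (3*1*3) ((1*2*3*4*5*6)*7))%AC.
exact: addrI.
Qed.

Lemma star0l (a : V) : (0 : V) ⋆ a = 0.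
Proof. by apply: (addrI ((0 : V) ⋆ a)); rewrite -starDl !addr0. Qed.

Lemma starNl (a b : V) : (- a : V) ⋆ b = - (a ⋆ b).
Proof. by apply: (addIr (a ⋆ b)); rewrite -starDl !addNr star0l. Qed.

(** If ab = b, then b and 0 have the same circle product with -a, which cancels in the circle
    group. *)
Lemma star_fix (a b : V) : a ⋆ b = b -> b = 0.
Proof.
move=> fixb; have : (- a : V) ∘ b = (- a : V) ∘ (0 : V).
  by rewrite circE starNl fixb addrK; exact/esym/sb_circ0.
exact: sb_circI.
Qed.

End CommutativeCirc.

(** * Consequences of the vanishing of all triple products *)

Section Class2.
Variables (T : finType) (A : skew_brace T).
Hypotheses (brA : is_brace A) (circC : forall a b, sb_circ A a b = sb_circ A b a).
Local Notation V := (brace_zmod brA).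
Local Notation "a ∘ b" := (sb_circ A a b : V) (at level 40, left associativity).
Local Notation "a ⋆ b" := (@brace_star T A brA a b) (at level 39, left associativity).
Import GRing.Theory.
Local Open Scope ring_scope.
Hypothesis star3 : forall a b c : V, a ⋆ (b ⋆ c) = 0.

Let starE := @starE T A brA.
Let starC := @starC T A brA circC.
Let starDl := @starDl T A brA circC.
Let starDr := @starDr T A brA.
Let circE := @circE T A brA.
Let lambdaE := @lambdaE T A brA.

Lemma star3l (a b c : V) : (a ⋆ b) ⋆ c = 0.
Proof. by rewrite starC star3. Qed.

Lemma circ_comm_two_sided : two_sided A.
Proof. by move=> a b c; rewrite circC sb_compat !(circC c). Qed.

Lemma class2_lambda_homomorphic : lambda_homomorphic A.
Proof.
have lambdaD (a b y : V) :
    sb_lambda A (a + b : V) y = sb_lambda A a (sb_lambda A b y) :> V.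
  by rewrite !lambdaE starDl starDr star3 addr0 addrA [RHS]addrAC.
exact: lambdaD.
Qed.

Lemma class2_bi_skew : bi_skew_brace A.
Proof.
(* The bi-skew law multiplied by a, which removes the circle inverse. *)
have circD (a b c : V) : a ∘ (a + b ∘ c : V) = (a + b : V) ∘ (a + c : V).
  rewrite !circE !(starDl, starDr) star3 addr0 (starC b a).
  rewrite [LHS](AC (1*(1*3)*(1*2)) (1*2*3*4*5*6*7*8))%AC.
  by rewrite [RHS](AC (2*2*(2*2)) (1*3*2*4*8*5*7*6))%AC.
move=> a b c; rewrite -sb_circA [X in _ = sb_circ A _ X]circC sb_circA.
apply: (sb_circI (A := A) (a := a)); rewrite [RHS]circC -sb_circA sb_circVl sb_circ1r.
exact: circD.
Qed.

Lemma class2_right_nilpotent : right_nilpotent A.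
Proof.
have rs1 (x : V) : right_series A 1 x -> forall y : V, x ⋆ y = 0.
  move=> rsx; apply: (rsx (fun x => forall y : V, x ⋆ y = 0)); last first.
    by move=> _ [a [b [_ _ ->]]] y; rewrite starE; exact: star3l.
  split=> [y|a b a0 b0 y|a a0 y].
  - exact: (@star0l T A brA circC).
  - by rewrite (starDl a b) a0 b0 addr0.
  by rewrite (@starNl T A brA circC a) a0 oppr0.
(* As [right_series] counts from 0, index 2 stands for A^(3), generated by products with a left
   factor in A^(2). *)
exists 2%N => x rsx; apply: (rsx (fun x => x = 0 :> V)).
  split=> [|a b -> ->|a ->] //; [exact: addr0 | exact: oppr0].
by move=> _ [a [b [ra _ ->]]]; rewrite starE; exact: rs1.
Qed.

Lemma socle_star (a b : V) : ann_series A 1 (a ⋆ b).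
Proof.
split; last by move=> y; rewrite (circC y) sb_circVl sb_one_zero.
split=> y; first by rewrite (brA y) sb_addNl.
have : - (y : V) + sb_lambda A (a ⋆ b) y = 0; last by [].
by rewrite lambdaE addKr star3l.
Qed.

(** All products lie in Ann(A), so modulo Ann(A) the star product is zero and the second term is
    A. *)
Lemma class2_annihilator_nilpotent : annihilator_nilpotent A.
Proof.
have ann0 : ann_series A 1 (0 : V).
  by rewrite -(star3 0 0 0); exact: socle_star.
exists 2%N => x; split; last by move=> y; rewrite (circC y) sb_circVl sb_one_zero.
split=> y; first by rewrite (brA y) sb_addNl.
have -> : sb_add A (sb_opp A y) (sb_lambda A x y) = (x : V) ⋆ (y : V).
  by have := addKr (y : V) ((x : V) ⋆ y); rewrite -lambdaE.
exact: socle_star.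
Qed.

(** The second component is found by cancellation: once triple products vanish, (b + ab) ∘ (a - ab)
    = a ∘ b. *)
Lemma class2_sol (a b : V) : sb_sol A (a, b) = (b + a ⋆ b, a - a ⋆ b) :> V * V.
Proof.
rewrite /sb_sol; congr (_, _); first exact: lambdaE.
apply: (sb_circI (A := A) (a := sb_lambda A a b)); rewrite sb_circNKl lambdaE.
have : a ∘ b = (b + a ⋆ b : V) ∘ (a - a ⋆ b : V); last by [].
rewrite !circE starDl star3l addr0 starDr.
rewrite (starC b (- _)) (starNl circC) star3l oppr0 addr0 (starC b a).
by congr (_ + _); rewrite addrACA subrr addr0 addrC.
Qed.

(** Changing an element by a product does not affect its action, so the first retraction identifies
    such elements; by [class2_sol] the second identifies everything. *)
Lemma class2_multipermutation : multipermutation (sb_sol A).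
Proof.
have ret1 (u a b c d : V) : ret_rel (sb_sol A) 1 (u + a ⋆ b : V) (u + c ⋆ d : V).
  move=> z; rewrite !class2_sol /= !starDl !starDr !star3 !star3l.
  by split.
have ret1N (u a b c d : V) : ret_rel (sb_sol A) 1 (u - a ⋆ b : V) (u - c ⋆ d : V).
  by rewrite -!(starNl circC); exact: ret1.
exists 2%N => x y z; rewrite !class2_sol; split; [exact: ret1 | exact: ret1N].
Qed.

End Class2.

Lemma cond10_star3 (T : finType) (A : skew_brace T) (brA : is_brace A) :
    (forall a b, sb_circ A a b = sb_circ A b a) -> cond10 #|T| ->
  forall a b c : brace_zmod brA, brace_star a (brace_star b c) = 0%R.
Proof.
move=> circC c10; apply: (@radical_mul3 (add_group A) (@brace_star T A brA)).
- exact: brA.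
- exact: (@starDl T A brA circC).
- exact: (@starC T A brA circC).
- exact: (@starA T A brA circC).
- exact: (@star_fix T A brA circC).
by rewrite card_add_group; case: c10.
Qed.

Lemma cond10_brace n : cond10 n -> all_sb n is_brace.
Proof.
move=> c10 T A cardT; apply: (@group_mulC_of_cond10 (add_group A)).
by rewrite card_add_group cardT.
Qed.

Lemma cond10_circC n : cond10 n ->
  all_sb n (fun T A => forall a b, sb_circ A a b = sb_circ A b a).
Proof.
move=> c10 T A cardT; apply: (@group_mulC_of_cond10 (circ_group A)).
by rewrite card_circ_group cardT.
Qed.

Definition trivial_brace (gT : finGroupType) : skew_brace gT.
Proof.
refine (@SkewBrace gT mulg 1%g invg mulg 1%g invg
  (@mulgA gT) (@mul1g gT) (@mulg1 gT) (@mulVg gT) (@mulgV gT)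
  (@mulgA gT) (@mul1g gT) (@mulg1 gT) (@mulVg gT) (@mulgV gT) _).
by move=> a b c; rewrite /= !mulgA mulgKV.
Defined.

(** * Direct products and passage to a factor *)

Section Product.
Variables (T1 T2 : Type) (A : skew_brace T1) (B : skew_brace T2).

Definition prod_brace : skew_brace (T1 * T2).
Proof.
refine (@SkewBrace (T1 * T2)
  (fun x y => (sb_add A x.1 y.1, sb_add B x.2 y.2)) (sb_zero A, sb_zero B)
  (fun x => (sb_opp A x.1, sb_opp B x.2))
  (fun x y => (sb_circ A x.1 y.1, sb_circ B x.2 y.2)) (sb_one A, sb_one B)
  (fun x => (sb_inv A x.1, sb_inv B x.2)) _ _ _ _ _ _ _ _ _ _ _).
- by move=> a b c; rewrite !sb_addA.
- by case=> a b; rewrite !sb_add0l.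
- by case=> a b; rewrite !sb_add0r.
- by move=> a; rewrite !sb_addNl.
- by move=> a; rewrite !sb_addNr.
- by move=> a b c; rewrite !sb_circA.
- by case=> a b; rewrite !sb_circ1l.
- by case=> a b; rewrite !sb_circ1r.
- by move=> a; rewrite !sb_circVl.
- by move=> a; rewrite !sb_circVr.
by move=> a b c; rewrite /= !sb_compat.
Defined.

Lemma prod_ret_rel k x y :
  ret_rel (sb_sol prod_brace) k x y -> ret_rel (sb_sol A) k x.1 y.1.
Proof.
elim: k x y => [|k IHk] x y /=; first by move->.
by move=> rel_xy z; have [/IHk ? /IHk ?] := rel_xy (z, sb_zero B).
Qed.

Lemma prod_soc_series m x : soc_series prod_brace m x -> soc_series A m x.1.
Proof.
elim: m x => [|m IHm] x /=; first by move->.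
by case=> cx lx; split=> y; [have /IHm := cx (y, sb_zero B)
                            | have /IHm := lx (y, sb_zero B)].
Qed.

(** Here the embedding of A is used rather than the projection, since right nilpotency asserts that
    members of the series vanish. *)
Lemma prod_right_series k x :
  right_series A k x -> right_series prod_brace k (x, sb_zero B).
Proof.
elim: k x => // k IHk x /= rsx P [P0 PD PN] Pstar.
apply: (rsx (fun y => P (y, sb_zero B))); first split=> // [y z Py Pz|y Py].
- by have := PD _ _ Py Pz; rewrite /= sb_add0l.
- by have := PN _ Py; rewrite /= sb_opp0.
move=> _ [y [z [ry _ ->]]]; apply: Pstar.
exists (y, sb_zero B), (z, sb_zero B); split=> //; first exact: IHk.
rewrite /sb_star /=; congr (_, _).
by rewrite sb_circ0 sb_addNl sb_addNr.
Qed.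

Lemma prod_multipermutation :
  multipermutation (sb_sol prod_brace) -> multipermutation (sb_sol A).
Proof.
case=> k retAB; exists k => x y.
exact: prod_ret_rel (retAB (x, sb_zero B) (y, sb_zero B)).
Qed.

Lemma prod_finite_mp_level : finite_mp_level prod_brace -> finite_mp_level A.
Proof.
by case=> m socAB; exists m => x; exact: prod_soc_series (socAB (x, sb_zero B)).
Qed.

Lemma prod_right_nilpotent : right_nilpotent prod_brace -> right_nilpotent A.
Proof. by case=> k rsAB; exists k => x /prod_right_series/rsAB[]. Qed.

Lemma prod_is_brace : is_brace prod_brace -> is_brace A.
Proof. by move=> brAB a b; have [] := brAB (a, sb_zero B) (b, sb_zero B). Qed.

Lemma prod_two_sided : two_sided prod_brace -> two_sided A.
Proof.
move=> tsAB a b c.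
by have [] := tsAB (a, sb_zero B) (b, sb_zero B) (c, sb_zero B).
Qed.

Lemma prod_bi_skew : bi_skew_brace prod_brace -> bi_skew_brace A.
Proof.
move=> bsAB a b c.
by have [] := bsAB (a, sb_zero B) (b, sb_zero B) (c, sb_zero B).
Qed.

Lemma prod_lambda_homomorphic : lambda_homomorphic prod_brace -> lambda_homomorphic A.
Proof.
move=> lhAB a b c.
by have [] := lhAB (a, sb_zero B) (b, sb_zero B) (c, sb_zero B).
Qed.

End Product.

(** * Criteria for the failure of the nilpotency properties *)

Section Irretractable.
Variables (T : Type) (A : skew_brace T).

(** If the first retraction identifies nothing, then by induction no iterated retraction does. *)
Lemma irretractable_not_mp (x y : T) :
    (forall a b, ret_rel (sb_sol A) 1 a b -> a = b) -> x <> y ->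
  ~ multipermutation (sb_sol A).
Proof.
move=> irrA neq_xy [k retA]; apply: neq_xy.
elim: k x y {retA}(retA x y) => //= k IHk x y rel_xy; apply: irrA => z /=.
by have [/IHk ? /IHk ?] := rel_xy z.
Qed.

Lemma trivial_soc_not_mp (x : T) :
    (forall a, soc_series A 1 a -> a = sb_zero A) -> x <> sb_zero A ->
  ~ finite_mp_level A.
Proof.
move=> soc0 neq_x0 [m socA]; apply: neq_x0.
elim: m x {socA}(socA x) => //= m IHm x [cx lx]; apply: soc0.
by split=> y; apply: IHm.
Qed.

(** The set S reproduces itself under the star product with A, so it survives in every term of the
    series. *)
Lemma star_stable_not_right_nilpotent (S : T -> Prop) (x : T) :
    (forall a, S a -> exists b c, S b /\ a = sb_star A b c) ->
    S x -> x <> sb_zero A ->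
  ~ right_nilpotent A.
Proof.
move=> stabS Sx neq_x0 [k rs0]; apply/neq_x0/rs0; elim: k x Sx {neq_x0 rs0} => //.
move=> k IHk _ /stabS[b [c [Sb ->]]] P _ Pstar; apply: Pstar.
by exists b, c; split=> //; exact: IHk.
Qed.

End Irretractable.

(** * A counterexample of order p^3 *)

Section HeisenbergBrace.
Import GRing.Theory.
Local Open Scope ring_scope.
Variable R : comNzRingType.

(** The circle group is the Heisenberg group with centre the middle coordinate. The additive group
    is a central extension with cocycle xy' - yx', which is symmetric in characteristic 2. *)
Definition heisenberg_brace : skew_brace (R * R * R).
Proof.
refine (@SkewBrace (R * R * R)
  (fun a b => let: (z, x, y) := a in let: (z', x', y') := b in
     (z + z' + (x * y' - y * x'), x + x', y + y'))
  (0, 0, 0)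
  (fun a => let: (z, x, y) := a in (- z, - x, - y))
  (fun a b => let: (z, x, y) := a in let: (z', x', y') := b in
     (z + z', x + x' + z * y', y + y'))
  (0, 0, 0)
  (fun a => let: (z, x, y) := a in (- z, - x + z * y, - y))
  _ _ _ _ _ _ _ _ _ _ _).
- by move=> [[? ?] ?] [[? ?] ?] [[? ?] ?]; congr (_, _, _); ring.
- by move=> [[? ?] ?]; congr (_, _, _); ring.
- by move=> [[? ?] ?]; congr (_, _, _); ring.
- by move=> [[? ?] ?]; congr (_, _, _); ring.
- by move=> [[? ?] ?]; congr (_, _, _); ring.
- by move=> [[? ?] ?] [[? ?] ?] [[? ?] ?]; congr (_, _, _); ring.
- by move=> [[? ?] ?]; congr (_, _, _); ring.
- by move=> [[? ?] ?]; congr (_, _, _); ring.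
- by move=> [[? ?] ?]; congr (_, _, _); ring.
- by move=> [[? ?] ?]; congr (_, _, _); ring.
by move=> [[? ?] ?] [[? ?] ?] [[? ?] ?]; congr (_, _, _); ring.
Defined.
Local Notation A := heisenberg_brace.

Lemma heisenberg_lambdaE z x y z' x' y' :
  sb_lambda A (z, x, y) (z', x', y') =
  (z' - x * y' + y * x' + y * z * y', x' + z * y', y').
Proof. by rewrite /sb_lambda /=; congr (_, _, _); ring. Qed.

(** The image of (0,1,0) reveals y, that of (0,0,1) reveals z and then x. *)
Lemma heisenberg_lambda_inj a b :
  (forall c, sb_lambda A a c = sb_lambda A b c) -> a = b.
Proof.
case: a b => [[z x] y] [[z' x'] y'] eq_ab.
have := eq_ab (0, 1, 0); rewrite !heisenberg_lambdaE => -[].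
rewrite !(mulr0, mulr1, oppr0, addr0, add0r) => eq_y.
have := eq_ab (0, 0, 1); rewrite !heisenberg_lambdaE => -[].
rewrite !(mulr0, mulr1, addr0, add0r) eq_y => + eq_z; rewrite eq_z.
by move/addIr/oppr_inj->.
Qed.

Lemma heisenberg_not_multipermutation : ~ multipermutation (sb_sol A).
Proof.
apply: (@irretractable_not_mp _ _ (1, 0, 0) (0, 0, 0)).
  by move=> a b rel_ab; apply: heisenberg_lambda_inj => c; case: (rel_ab c).
by case=> /eqP; rewrite oner_eq0.
Qed.

Lemma heisenberg_not_finite_mp_level : ~ finite_mp_level A.
Proof.
apply: (@trivial_soc_not_mp _ _ (1, 0, 0)); last by case=> /eqP; rewrite oner_eq0.
move=> a [_ la]; apply: heisenberg_lambda_inj => -[[z x] y].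
have := la (z, x, y) => /(congr1 (sb_add A (z, x, y))).
rewrite sb_addNKl sb_add0r => ->.
by rewrite [sb_zero _]/= heisenberg_lambdaE; congr (_, _, _); ring.
Qed.

Lemma heisenberg_not_right_nilpotent : ~ right_nilpotent A.
Proof.
apply: (@star_stable_not_right_nilpotent _ _ (fun a => a.2 = 0) (1, 0, 0)) => //.
  (* The star product of (Z,X,0) and (0,0,1) is (-X-Z,Z,0); the witness solves this for Z and X. *)
  move=> [[z x] y] /= ->; exists (x, - z - x, 0), (0, 0, 1); split=> //.
  by rewrite /sb_star /=; congr (_, _, _); ring.
by case=> /eqP; rewrite oner_eq0.
Qed.

(** The sum (0,1,0) + (0,0,1) acquires first coordinate 1, which circle multiplication by (0,0,1)
    moves into the middle coordinate. The same triple refutes the next two laws. *)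
Lemma heisenberg_not_two_sided : ~ two_sided A.
Proof.
move=> /(_ (0, 1, 0) (0, 0, 1) (0, 0, 1)) [_ /eqP + _].
by rewrite -subr_eq0 (_ : _ - _ = 1) ?oner_eq0 //=; ring.
Qed.

Lemma heisenberg_not_bi_skew : ~ bi_skew_brace A.
Proof.
move=> /(_ (0, 1, 0) (0, 0, 1) (0, 0, 1)) [_ /eqP + _].
by rewrite eq_sym -subr_eq0 (_ : _ - _ = 1) ?oner_eq0 //=; ring.
Qed.

Lemma heisenberg_not_lambda_homomorphic : ~ lambda_homomorphic A.
Proof.
move=> /(_ (0, 1, 0) (0, 0, 1) (0, 0, 1)).
rewrite [sb_add _ _ _]/= !heisenberg_lambdaE => -[_ /eqP].
by rewrite -subr_eq0 (_ : _ - _ = 1) ?oner_eq0 //=; ring.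
Qed.

Lemma heisenberg_circ_noncomm : exists a b, sb_circ A a b <> sb_circ A b a.
Proof.
exists (1, 0, 0), (0, 0, 1) => -[_ /eqP + _].
by rewrite -subr_eq0 (_ : _ - _ = 1) ?oner_eq0 //=; ring.
Qed.

End HeisenbergBrace.

(** * Counterexamples of order p q^k from a character of C with values in F *)

Section SemidirectBraces.
Import GRing.Theory.
Local Open Scope ring_scope.
Variables (C : zmodType) (F : fieldType) (chi : C -> F).
Hypotheses (chi0 : chi 0 = 1) (chiD : forall c d, chi (c + d) = chi c * chi d).

Lemma chiNK c : chi c * chi (- c) = 1.
Proof. by rewrite -chiD subrr. Qed.

Definition semidirect_add_brace : skew_brace (C * F).
Proof.
refine (@SkewBrace (C * F)
  (fun a b => (a.1 + b.1, chi b.1 * a.2 + b.2)) (0, 0)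
  (fun a => (- a.1, - (chi (- a.1) * a.2)))
  (fun a b => (a.1 + b.1, a.2 + b.2)) (0, 0)
  (fun a => (- a.1, - a.2)) _ _ _ _ _ _ _ _ _ _ _) => /=.
- by move=> a b c; rewrite chiD addrA; congr (_, _); ring.
- by move=> [a b]; rewrite /= add0r mulr0 add0r.
- by move=> [a b]; rewrite /= chi0 !addr0 mul1r.
- by move=> [a b] /=; rewrite addNr mulrN mulrA chiNK mul1r addNr.
- by move=> [a b] /=; rewrite !subrr.
- by move=> a b c; rewrite !addrA.
- by move=> [a b]; rewrite /= !add0r.
- by move=> [a b]; rewrite /= !addr0.
- by move=> [a b]; rewrite /= !addNr.
- by move=> [a b]; rewrite /= !subrr.
move=> [a a'] [b b'] [c c'] /=; congr (_, _).
  by rewrite [a + b - a]addrAC subrr add0r addrCA.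
rewrite chiD; transitivity (chi c * (chi a * chi (- a)) * b' + (a' + c')).
  by rewrite chiNK; ring.
by ring.
Defined.
Local Notation A := semidirect_add_brace.

Lemma semidirect_lambdaE a b : sb_lambda A a b = (b.1, b.2 + (1 - chi b.1) * a.2).
Proof.
rewrite /sb_lambda /=; congr (_, _); first by rewrite addrA addNr add0r.
rewrite chiD; transitivity (b.2 + (1 - chi a.1 * chi (- a.1) * chi b.1) * a.2).
  by ring.
by rewrite chiNK mul1r.
Qed.

Lemma semidirect_sol a b :
  sb_sol A (a, b) = ((b.1, b.2 + (1 - chi b.1) * a.2), (a.1, chi b.1 * a.2)).
Proof.
rewrite /sb_sol semidirect_lambdaE /=; congr (_, (_, _)); last by ring.
by rewrite addrCA addNr addr0.
Qed.

Hypothesis (chi_inj : injective chi).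
Variables (c0 : C) (c0_neq0 : c0 != 0).

Lemma chi_neq1 c : c != 0 -> 1 - chi c != 0.
Proof.
by apply: contraNneq => /eqP; rewrite subr_eq0 -chi0 => /eqP/chi_inj->.
Qed.

Lemma semidirect_not_multipermutation : ~ multipermutation (sb_sol A).
Proof.
apply: (@irretractable_not_mp _ _ (0, 1) (0, 0)); last first.
  by case=> /eqP; rewrite oner_eq0.
move=> [a a'] [b b'] rel_ab.
(* The map λ sees only the F-coordinate, through the factor 1 - χ(c0); the C-coordinate is recovered
   from ρ. *)
have [lab _] := rel_ab (c0, 0); have [_ rab] := rel_ab (0, 1).
move: lab rab; rewrite !semidirect_sol /=.
case=> /addrI/(mulfI (chi_neq1 c0_neq0))-> [].
by rewrite !mulr1 => /chi_inj->.
Qed.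

Lemma semidirect_not_finite_mp_level : ~ finite_mp_level A.
Proof.
apply: (@trivial_soc_not_mp _ _ (0, 1)); last by case=> /eqP; rewrite oner_eq0.
move=> [a a'] [ca la].
have /(congr1 (sb_add A (c0, 0))) := la (c0, 0).
rewrite sb_addNKl sb_add0r semidirect_lambdaE /= => -[].
rewrite add0r => /eqP; rewrite mulf_eq0 (negPf (chi_neq1 c0_neq0)) /= => /eqP a'0.
have /(congr1 (sb_add A (sb_add A (0, 1) (a, a')))) := ca (0, 1).
rewrite sb_addNKl sb_add0r a'0 /= => -[_].
by rewrite mulr0 mulr1 add0r addr0 -chi0 => /chi_inj <-.
Qed.

Lemma semidirect_not_right_nilpotent : ~ right_nilpotent A.
Proof.
apply: (@star_stable_not_right_nilpotent _ _ (fun a => a.1 = 0) (0, 1)) => //.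
  (* The star product of (0,v) and (-c0,0) is (0,(χ(c0) - 1)v), so v is a' divided by χ(c0) - 1. *)
  move=> [a a'] /= ->; exists (0, - a' / (1 - chi c0)), (- c0, 0); split=> //.
  rewrite /sb_star /= !(oppr0, add0r, addr0, opprK, mulr0) chi0 mul1r addNr.
  congr (_, _); set v := _ / _.
  transitivity (- (1 - chi c0) * v).
    by rewrite mulNr mulrCA mulfV ?chi_neq1 // mulr1 opprK.
  by rewrite -(chiNK c0); ring.
by case=> /eqP; rewrite oner_eq0.
Qed.

Lemma semidirect_not_brace : ~ is_brace A.
Proof.
move=> /(_ (c0, 0) (0, 1)) [_ /eqP].
by rewrite mulr0 add0r mulr1 addr0 -subr_eq0 (negPf (chi_neq1 c0_neq0)).
Qed.

Lemma semidirect_not_bi_skew : ~ bi_skew_brace A.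
Proof.
move=> /(_ (0, 1) (c0, 0) (c0, 0)) [_ /eqP].
rewrite chiD -subr_eq0.
rewrite (_ : _ - _ = (1 - chi c0) * (1 - chi c0)) /=; last by ring.
by rewrite mulf_eq0 orbb (negPf (chi_neq1 c0_neq0)).
Qed.

(** The map λ is governed by the F-coordinate, which adding (c0,0) on the right rescales by
    χ(c0). *)
Lemma semidirect_not_lambda_homomorphic : ~ lambda_homomorphic A.
Proof.
move=> /(_ (0, 1) (c0, 0) (c0, 0)); rewrite !semidirect_lambdaE /= => -[/eqP].
rewrite -subr_eq0.
rewrite (_ : _ - _ = - ((1 - chi c0) * (1 - chi c0))) /=; last by ring.
by rewrite oppr_eq0 mulf_eq0 orbb (negPf (chi_neq1 c0_neq0)).
Qed.

(** The two group laws trade places here: [semidirect_add_brace] has a commutative circle group and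
    is therefore two-sided. *)
Definition semidirect_circ_brace : skew_brace (C * F).
Proof.
refine (@SkewBrace (C * F)
  (fun a b => (a.1 + b.1, a.2 + b.2)) (0, 0) (fun a => (- a.1, - a.2))
  (fun a b => (a.1 + b.1, a.2 + chi a.1 * b.2)) (0, 0)
  (fun a => (- a.1, - (chi (- a.1) * a.2))) _ _ _ _ _ _ _ _ _ _ _) => /=.
- by move=> a b c; rewrite !addrA.
- by move=> [a b]; rewrite /= !add0r.
- by move=> [a b]; rewrite /= !addr0.
- by move=> [a b]; rewrite /= !addNr.
- by move=> [a b]; rewrite /= !subrr.
- by move=> a b c; rewrite chiD addrA; congr (_, _); ring.
- by move=> [a b]; rewrite /= chi0 !add0r mul1r.
- by move=> [a b]; rewrite /= addr0 mulr0 addr0.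
- by move=> [a b] /=; rewrite !addNr.
- by move=> [a b] /=; rewrite subrr mulrN mulrA chiNK mul1r subrr.
move=> [a a'] [b b'] [c c'] /=; congr (_, _); last by ring.
by rewrite [a + b - a]addrAC subrr add0r addrCA.
Defined.

Lemma semidirect_not_two_sided : ~ two_sided semidirect_circ_brace.
Proof.
move=> /(_ (c0, 0) (c0, 0) (0, 1)) [_ /eqP].
rewrite chiD -subr_eq0.
rewrite (_ : _ - _ = (1 - chi c0) * (1 - chi c0)) /=; last by ring.
by rewrite mulf_eq0 orbb (negPf (chi_neq1 c0_neq0)).
Qed.

End SemidirectBraces.

(** * From counterexamples to the arithmetic condition *)

(** The character maps Z/p onto the powers of a unit of order p, which exists by Cauchy's theorem as
    the unit group has order q^k - 1. *)
Lemma exists_field_character p q k :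
    prime p -> prime q -> 0 < k -> p %| q ^ k - 1 ->
  exists (F : finFieldType) (C : finZmodType) (chi : C -> F) (c0 : C),
    [/\ #|C| = p, #|F| = (q ^ k)%N & c0 != 0%R] /\
    [/\ chi 0%R = 1%R, injective chi &
        forall c d, chi (c + d)%R = (chi c * chi d)%R].
Proof.
(* The successor form of p gives ['I_p.+2] its structure of integers modulo p. *)
case: p => [|[|p]] // p_pr q_pr k_gt0 p_dvd.
have [F _ cardF] := pPrimePowerField q_pr k_gt0.
have [] := @Cauchy {unit F} _ [set: {unit F}]%G p_pr.
  by rewrite card_finField_unit cardF -subn1.
move=> u _ ou; exists F, 'I_p.+2, (fun c : 'I_p.+2 => FinRing.uval (u ^+ c)%g), 1%R.
split; split=> //; first by rewrite card_ord.
  move=> c d /val_inj/eqP; rewrite eq_expg_mod_order ou !modn_small //.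
  by move/eqP/val_inj.
by move=> c d; rewrite -FinRing.val_unitM -expgD -(expg_mod_order u (c + d)) ou.
Qed.

Lemma cond10_intro n :
    0 < n ->
    (forall p, prime p -> ~~ (p ^ 3 %| n)) ->
    (forall p q k, prime p -> prime q -> 0 < k -> p %| q ^ k - 1 ->
       ~~ (p * q ^ k %| n)) ->
  cond10 n.
Proof.
move=> n_gt0 no_cube no_semidirect; split=> [p|p q].
  rewrite mem_primes => /andP[p_pr _]; rewrite leqNgt.
  by apply: contra (no_cube p p_pr) => ?; rewrite pfactor_dvdn.
rewrite !mem_primes => /and3P[p_pr _ p_dvd] /and3P[q_pr _ q_dvd] neq_pq.
have k_gt0 : 0 < logn q n by rewrite logn_gt0 mem_primes q_pr n_gt0.
apply/negP=> p_dvd1; have /negP := no_semidirect p q _ p_pr q_pr k_gt0 p_dvd1.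
apply; rewrite Gauss_dvd ?p_dvd ?pfactor_dvdnn //.
by rewrite coprimeXr // prime_coprime // dvdn_prime2.
Qed.

Definition factor_closed (P : forall T : Type, skew_brace T -> Prop) :=
  forall (T1 T2 : Type) (A : skew_brace T1) (B : skew_brace T2),
    P _ (prod_brace A B) -> P _ A.

(** A is padded to order n by the trivial skew brace on a cyclic group of order n / |T|. *)
Lemma all_sb_factor n P (T : finType) (A : skew_brace T) :
  0 < n -> factor_closed P -> #|T| %| n -> all_sb n P -> P T A.
Proof.
move=> n_gt0 factP /dvdnP[[|m] def_n] allP; first by rewrite def_n in n_gt0.
apply: (@factP _ _ A (trivial_brace 'I_m.+1)); apply: (allP (T * 'I_m.+1)%type).
by rewrite card_prod card_ord def_n mulnC.
Qed.

Lemma all_sb_cond10 n P :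
    0 < n -> factor_closed P ->
    (forall R : finFieldType,
       exists A : skew_brace (R * R * R), ~ P _ A) ->
    (forall (C : finZmodType) (F : finFieldType) (chi : C -> F) (c0 : C),
       c0 != 0%R -> chi 0%R = 1%R -> injective chi ->
       (forall c d, chi (c + d)%R = (chi c * chi d)%R) ->
       exists A : skew_brace (C * F), ~ P _ A) ->
  all_sb n P -> cond10 n.
Proof.
move=> n_gt0 factP cube_ex semidirect_ex allP.
apply: cond10_intro => // [p p_pr | p q k p_pr q_pr k_gt0 p_dvd]; apply/negP=> n_dvd.
  have [A nPA] := cube_ex 'F_p.
  apply: nPA; apply: (@all_sb_factor n P ('F_p * 'F_p * 'F_p)%type A) => //.
  by rewrite !card_prod card_Fp // -mulnA.
have [F [C [chi [c0 [[cardC cardF c0_neq0] [chi0 chi_inj chiD]]]]]] :=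
  exists_field_character p_pr q_pr k_gt0 p_dvd.
have [A nPA] := semidirect_ex C F chi c0 c0_neq0 chi0 chi_inj chiD.
apply: nPA; apply: (@all_sb_factor n P (C * F)%type A) => //.
by rewrite card_prod cardC cardF.
Qed.

(** * Transfer along isomorphisms of solutions *)

Lemma sol_iso_refl (X : Type) (r : X * X -> X * X) : sol_iso r r.
Proof. by exists id; split=> [|x y]; [exists id | case: (r _)]. Qed.

Lemma sol_iso_ret_rel (X Y : Type) (r : X * X -> X * X) (s : Y * Y -> Y * Y) f g k x y :
    cancel g f -> (forall x y, s (f x, f y) = (f (r (x, y)).1, f (r (x, y)).2)) ->
  ret_rel r k x y -> ret_rel s k (f x) (f y).
Proof.
move=> gK f_morph; elim: k x y => [|k IHk] x y /=; first by move->.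
move=> rel_xy z; rewrite -[z]gK !f_morph /=.
by have [/IHk ? /IHk ?] := rel_xy (g z).
Qed.

Lemma all_sb_multipermutation n :
  all_sb_sol n multipermutation <->
  all_sb n (fun T A => multipermutation (sb_sol A)).
Proof.
split=> [allP T A cardT | allP X r [T [A [cardT [f [[g fK gK] f_morph]]]]]].
  by apply: allP; exists T, A; split=> //; exact: sol_iso_refl.
have [k retA] := allP T A cardT; exists k => x y.
by rewrite -[x]gK -[y]gK; apply: sol_iso_ret_rel gK f_morph (retA _ _).
Qed.

Lemma all_sb_involutive n : all_sb_sol n involutive_sol <-> all_sb n is_brace.
Proof.
split=> [allP T A cardT | allP X r [T [A [cardT [f [[g fK gK] f_morph]]]]] [x y]].
  apply/involutive_sol_brace; apply: allP; exists T, A.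
  by split=> //; exact: sol_iso_refl.
have /involutive_sol_brace invA := allP T A cardT.
rewrite -[x]gK -[y]gK f_morph; have := invA (g x, g y).
by case: (sb_sol A (g x, g y)) => u v inv_uv; rewrite f_morph inv_uv.
Qed.

(** * Each property implies the arithmetic condition; the equivalence *)

Section MainImplications.
Variables (n : nat) (n_gt0 : 0 < n).

Lemma multipermutation_cond10 : all_sb_sol n multipermutation -> cond10 n.
Proof.
move/all_sb_multipermutation; apply: all_sb_cond10 => //.
- by move=> T1 T2 A B; exact: prod_multipermutation.
- move=> R; exists (heisenberg_brace R); exact: heisenberg_not_multipermutation.
move=> C F chi c0 c0_neq0 chi0 chi_inj chiD.
exists (semidirect_add_brace chi0 chiD).
exact: semidirect_not_multipermutation chi_inj _ c0_neq0.
Qed.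

Lemma finite_mp_level_cond10 : all_sb n finite_mp_level -> cond10 n.
Proof.
apply: all_sb_cond10 => //.
- by move=> T1 T2 A B; exact: prod_finite_mp_level.
- move=> R; exists (heisenberg_brace R); exact: heisenberg_not_finite_mp_level.
move=> C F chi c0 c0_neq0 chi0 chi_inj chiD.
exists (semidirect_add_brace chi0 chiD).
exact: semidirect_not_finite_mp_level chi_inj _ c0_neq0.
Qed.

Lemma annihilator_nilpotent_cond10 : all_sb n annihilator_nilpotent -> cond10 n.
Proof.
move=> allP; apply: finite_mp_level_cond10 => T A cardT.
exact/annihilator_nilpotent_mp/allP.
Qed.

Lemma right_nilpotent_cond10 : all_sb n right_nilpotent -> cond10 n.
Proof.
apply: all_sb_cond10 => //.
- by move=> T1 T2 A B; exact: prod_right_nilpotent.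
- move=> R; exists (heisenberg_brace R); exact: heisenberg_not_right_nilpotent.
move=> C F chi c0 c0_neq0 chi0 chi_inj chiD.
exists (semidirect_add_brace chi0 chiD).
exact: semidirect_not_right_nilpotent chi_inj _ c0_neq0.
Qed.

Lemma brace_cond10 : all_sb n is_brace -> cond10 n.
Proof.
apply: all_sb_cond10 => //.
- by move=> T1 T2 A B; exact: prod_is_brace.
(* In characteristic 2 the Heisenberg brace has commutative addition, so its circle group is used as
   the additive group instead. *)
- move=> R; have [a [b neq_ab]] := heisenberg_circ_noncomm R.
  exists (trivial_brace (circ_group (heisenberg_brace R))).
  by move/(_ a b)/neq_ab.
move=> C F chi c0 c0_neq0 chi0 chi_inj chiD.
exists (semidirect_add_brace chi0 chiD).
exact: semidirect_not_brace chi_inj _ c0_neq0.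
Qed.

Lemma two_sided_cond10 : all_sb n two_sided -> cond10 n.
Proof.
apply: all_sb_cond10 => //.
- by move=> T1 T2 A B; exact: prod_two_sided.
- move=> R; exists (heisenberg_brace R); exact: heisenberg_not_two_sided.
move=> C F chi c0 c0_neq0 chi0 chi_inj chiD.
exists (semidirect_circ_brace chi0 chiD).
exact: semidirect_not_two_sided chi_inj _ c0_neq0.
Qed.

Lemma bi_skew_cond10 : all_sb n bi_skew_brace -> cond10 n.
Proof.
apply: all_sb_cond10 => //.
- by move=> T1 T2 A B; exact: prod_bi_skew.
- move=> R; exists (heisenberg_brace R); exact: heisenberg_not_bi_skew.
move=> C F chi c0 c0_neq0 chi0 chi_inj chiD.
exists (semidirect_add_brace chi0 chiD).
exact: semidirect_not_bi_skew chi_inj _ c0_neq0.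
Qed.

Lemma lambda_homomorphic_cond10 : all_sb n lambda_homomorphic -> cond10 n.
Proof.
apply: all_sb_cond10 => //.
- by move=> T1 T2 A B; exact: prod_lambda_homomorphic.
- move=> R; exists (heisenberg_brace R); exact: heisenberg_not_lambda_homomorphic.
move=> C F chi c0 c0_neq0 chi0 chi_inj chiD.
exists (semidirect_add_brace chi0 chiD).
exact: semidirect_not_lambda_homomorphic chi_inj _ c0_neq0.
Qed.

End MainImplications.

Theorem theorem5p1 (n : nat) (hn : 0 < n) :
  [<-> all_sb_sol n multipermutation;
       all_sb_sol n involutive_sol;
       all_sb n finite_mp_level;
       all_sb n right_nilpotent;
       all_sb n annihilator_nilpotent;
       all_sb n is_brace;
       all_sb n two_sided;
       all_sb n bi_skew_brace;
       all_sb n lambda_homomorphic;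
       cond10 n].
Proof.
have class2 (P : forall T : Type, skew_brace T -> Prop) :
    (forall (T : finType) (A : skew_brace T) (brA : is_brace A),
       (forall a b, sb_circ A a b = sb_circ A b a) ->
       (forall a b c : brace_zmod brA, brace_star a (brace_star b c) = 0%R) ->
       P T A) -> cond10 n -> all_sb n P.
  move=> PA c10 T A cardT; have circC := cond10_circC c10 A cardT.
  apply: (PA T A (cond10_brace c10 A cardT) circC).
  by apply: cond10_star3; rewrite ?cardT.
have ann := class2 _ class2_annihilator_nilpotent.
(* Every link of the cycle goes through [cond10], which [class2] turns into most of the
   properties. *)
tfae.
- move/(multipermutation_cond10 hn)=> c10.
  exact/all_sb_involutive/cond10_brace.
- move/all_sb_involutive/(brace_cond10 hn)/ann=> annP T A cardT.
  exact/annihilator_nilpotent_mp/annP.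
- by move/(finite_mp_level_cond10 hn)/(class2 _ class2_right_nilpotent).
- by move/(right_nilpotent_cond10 hn)/ann.
- by move/(annihilator_nilpotent_cond10 hn)/cond10_brace.
- move/(brace_cond10 hn) => c10 T A cardT.
  exact: circ_comm_two_sided (cond10_circC c10 A cardT).
- by move/(two_sided_cond10 hn)/(class2 _ class2_bi_skew).
- by move/(bi_skew_cond10 hn)/(class2 _ class2_lambda_homomorphic).
- exact: lambda_homomorphic_cond10.
move=> c10; apply/all_sb_multipermutation.
exact: class2 class2_multipermutation c10.
Qed.
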